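(* For all real numbers $[a],[b]\in\mathcal{S}_{\mathbb{R}}$: if $[a]\le[b]$ and $[b]\le[a]$ then $[a]=[b]$.
   Context: Conventions. $\omega=\{0,1,2,\dots\}$, $\omega_+=\omega\setminus\{0\}$, $[a,b]_\omega=\{n\in\omega:a\le n\le b\}$, $[a,\infty]_\omega=\{n\in\omega:n\ge a\}$. A system function $\vartheta:\omega_+\to[2,\infty]_\omega$ is fixed. Contractions. For $f:\omega\to\omega$ and $n\in\omega_+$, the contraction $c_n$ is applicable to $f$ iff $f(n+1)\ge\vartheta(n)$, and then $c_n(f)(n)=f(n)+1$, $c_n(f)(n+1)=f(n+1)-\vartheta(n)$, $c_n(f)(k)=f(k)$ for other $k$. A sequence of contractions is a finite (possibly empty) composition of contractions; it is applicable to $f$ iff each contraction in turn is applicable to the result of the preceding ones. Sign. For $f:\omega\to\omega$, $\sigma(f)=0$ if $f(0)$ is odd and $\sigma(f)=1$ if $f(0)$ is even. Auxiliary functions. $h:\omega\to\omega$ is a primary auxiliary function ($h\in A_p$) if $h(k)<\vartheta(k-1)$ for all $k\ge2$ and for every $N\in\omega_+$ there is $M\ge N+1$ with $h(M)\ne\vartheta(M-1)-1$. It is a secondary auxiliary function ($h\in A_s$) if $h(k)<\vartheta(k-1)$ for all $k\ge2$ and there is $N\in\omega_+$ with $h(M)=\vartheta(M-1)-1$ for all $M\ge N+1$; the least such $N$ is $N^h_{\min}$. Base set. $W_1$ is the set of pairs $(h_p,h_s)\in A_p\times A_s$ such that, with $N=N^{h_s}_{\min}$, $h_p(k)=h_s(k)$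 for $k<N$, $h_p(N)=h_s(N)+1$, and $h_p(k)=0$ for $k>N$. Two pairs in $W_1$ are equivalent if their first components agree on $\omega_+$ and have the same sign; $F$ is the collection of sets obtained by taking, for each equivalence class, the set of all functions that are components of its pairs. $W_2$ is the set of primary auxiliary functions occurring in no pair of $W_1$; two elements of $W_2$ are equivalent if they agree on $\omega_+$ and have the same sign; $G_2$ is the set of equivalence classes. The base set is $B=F\cup G_2$. Real numbers. For $b\in B$, $r_b$ is the set of $f:\omega\to\omega$ for which there is $h\in b$ such that for every $N\in\omega_+$ some sequence of contractions $\mathcal{C}$ applicable to $f$ satisfies $\mathcal{C}(f)(n)=h(n)$ for all $n\in[0,N]_\omega$. Let $b_1,b_2\in B$ be the elements containing respectively the zero function, and the function with value $1$ at $0$ and $0$ elsewhere. $\mathcal{S}_{\mathbb{R}}$ (the set of real numbers) consists of all $r_b$ with $b\in B\setminus\{b_1,b_2\}$ together with $[0]:=r_{b_1}\cup r_{b_2}$. Put $\mathcal{S}_{\mathbb{R}}^*=\mathcal{S}_{\mathbb{R}}\setminus\{[0]\}$. Distinct real numbers are disjoint. A function lying in some real number is called finite, and $[f]$ denotes the real number containing $f$. For $[a]\in\mathcal{S}_{\mathbb{R}}^*$ all elements have the same sign, denoted $\sigma([a])$. Order. For $[a],[b]\in\mathcal{S}_{\mathbb{R}}^*$, $[a]\le[b]$ iff one of the following holds: (i) $\sigma([a])<\sigma([b])$; (ii) $\sigma([a])=\sigma([b])=1$ and for every $a\in[a]$ there is $b\in[b]$ with $a(n)\le b(n)$ for all $n\in\omega_+$;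 (iii) $\sigma([a])=\sigma([b])=0$ and for every $b\in[b]$ there is $a\in[a]$ with $a(n)\ge b(n)$ for all $n\in\omega_+$. For $[a]\in\mathcal{S}_{\mathbb{R}}^*$, $[a]\le[0]$ iff $\sigma([a])=0$, and $[0]\le[a]$ iff $\sigma([a])=1$. Finally $[0]\le[0]$ holds. *)

(* Defs.v *)
From mathcomp Require Import all_boot.
From mathcomp Require Import boolp classical_sets.

Set Implicit Arguments.
Unset Strict Implicit.
Unset Printing Implicit Defensive.

Local Open Scope classical_set_scope.

(* The system function theta : omega_+ -> {2, 3, ...} is a total function on
   nat constrained by this predicate; theta 0 is never used. *)
Definition system_function (theta : nat -> nat) : Prop :=
  forall n, 0 < n -> 2 <= theta n.

Definition contraction (theta : nat -> nat) (n : nat) (f : nat -> nat) :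
    nat -> nat :=
  fun k => if k == n then (f n).+1
           else if k == n.+1 then f n.+1 - theta n
           else f k.

(* A sequence of contractions is given by the list of its indices; the head of
   the list is applied first. *)
Definition contractions (theta : nat -> nat) (s : seq nat) (f : nat -> nat) :
    nat -> nat :=
  foldl (fun g n => contraction theta n g) f s.

Fixpoint applicable (theta : nat -> nat) (s : seq nat) (f : nat -> nat) :
    bool :=
  if s is n :: s' then
    [&& 0 < n, theta n <= f n.+1 & applicable theta s' (contraction theta n f)]
  else true.

Definition sign (f : nat -> nat) : nat := if odd (f 0) then 0 else 1.

Definition digits_bounded (theta h : nat -> nat) : Prop :=
  forall k, 2 <= k -> h k < theta k.-1.

Definition maximal_after (theta h : nat -> nat) (N : nat) : Prop :=
  forall M, N.+1 <= M -> h M = (theta M.-1).-1.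

Definition primary (theta : nat -> nat) : set (nat -> nat) :=
  [set h | digits_bounded theta h /\
    forall N, 0 < N -> exists2 M, N.+1 <= M & h M <> (theta M.-1).-1].

Definition secondary (theta : nat -> nat) : set (nat -> nat) :=
  [set h | digits_bounded theta h /\
    exists2 N, 0 < N & maximal_after theta h N].

Definition is_Nmin (theta h : nat -> nat) (N : nat) : Prop :=
  [/\ 0 < N, maximal_after theta h N &
      forall N', 0 < N' -> maximal_after theta h N' -> N <= N'].

Definition W1 (theta : nat -> nat) : set ((nat -> nat) * (nat -> nat)) :=
  [set p | primary theta p.1 /\ secondary theta p.2 /\
    exists N, [/\ is_Nmin theta p.2 N,
                  forall k, k < N -> p.1 k = p.2 k,
                  p.1 N = (p.2 N).+1 &
                  forall k, N < k -> p.1 k = 0]].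

Definition same_sign_tail (g h : nat -> nat) : Prop :=
  (forall n, 0 < n -> g n = h n) /\ sign g = sign h.

Definition F (theta : nat -> nat) : set (set (nat -> nat)) :=
  [set b | exists2 p, W1 theta p &
    b = [set h | exists q, [/\ W1 theta q, same_sign_tail q.1 p.1 &
                               h = q.1 \/ h = q.2]]].

Definition W2 (theta : nat -> nat) : set (nat -> nat) :=
  [set h | primary theta h /\
    forall p, W1 theta p -> h <> p.1 /\ h <> p.2].

Definition G2 (theta : nat -> nat) : set (set (nat -> nat)) :=
  [set b | exists2 h, W2 theta h &
    b = [set g | W2 theta g /\ same_sign_tail g h]].

Definition base (theta : nat -> nat) : set (set (nat -> nat)) :=
  F theta `|` G2 theta.

Definition realize (theta : nat -> nat) (b : set (nat -> nat)) :
    set (nat -> nat) :=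
  [set f | exists2 h, b h &
    forall N, 0 < N -> exists2 s, applicable theta s f &
      forall n, n <= N -> contractions theta s f n = h n].

(* The element of the base containing h; see base_ofP for the two functions to
   which it is applied. *)
Definition base_of (theta h : nat -> nat) : set (nat -> nat) :=
  xget set0 [set b | base theta b /\ b h].

Definition zero_fun : nat -> nat := fun=> 0.
Definition delta0_fun : nat -> nat := fun n => if n == 0 then 1 else 0.

Definition b1 (theta : nat -> nat) : set (nat -> nat) :=
  base_of theta zero_fun.
Definition b2 (theta : nat -> nat) : set (nat -> nat) :=
  base_of theta delta0_fun.

Lemma base_ofP (theta h : nat -> nat) : system_function theta ->
  h = zero_fun \/ h = delta0_fun ->
  [/\ base theta (base_of theta h), base_of theta h h &
      forall b, base theta b -> b h -> b = base_of theta h].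
Proof.
move=> htheta hE.
have h0 n : 0 < n -> h n = 0 by case: hE => -> //; case: n.
have ph : primary theta h.
  split=> [k k2|N N0].
    by rewrite h0 ?(ltnW k2)// (leq_trans _ (htheta _ _)) //; case: k k2 => [|[]].
  by exists N.+1 => //; rewrite h0 //=; case: (theta N) (htheta _ N0) => [|[]].
have nW1 p : W1 theta p -> h <> p.1 /\ h <> p.2.
  move=> [_ [_ [N [[N0 mN _] _ pN _]]]]; split=> E.
    by move: pN; rewrite -E h0.
  have /= := mN N.+1 (leqnn _); rewrite -E h0 //.
  by case: (theta N) (htheta _ N0) => [|[]].
have W2h : W2 theta h by [].
have uniq b : base theta b -> b h ->
    b = [set g | W2 theta g /\ same_sign_tail g h].
  move=> [[p _ ->] [q [/nW1[h1 h2] _]] []//|[g W2g ->] [_ [e s]]].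
  apply/seteqP; split=> x [W2x [ex sx]]; split=> //; split.
  - by move=> n n0; rewrite ex ?e.
  - by rewrite sx s.
  - by move=> n n0; rewrite ex ?e.
  - by rewrite sx s.
have ex : [set b | base theta b /\ b h]
    [set g | W2 theta g /\ same_sign_tail g h].
  by split; [right; exists h|].
have [Bb bh] := xgetI set0 ex.
by split=> // b Bb' bh'; rewrite (uniq _ Bb' bh') -(uniq _ Bb bh).
Qed.

Definition zeroR (theta : nat -> nat) : set (nat -> nat) :=
  realize theta (b1 theta) `|` realize theta (b2 theta).

Definition reals (theta : nat -> nat) : set (set (nat -> nat)) :=
  realize theta @` (base theta `\` [set b1 theta; b2 theta])
  `|` [set zeroR theta].

Definition nz_reals (theta : nat -> nat) : set (set (nat -> nat)) :=
  reals theta `\` [set zeroR theta].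

(* The common sign of the elements of a; see sigmaP. *)
Definition sigma (a : set (nat -> nat)) : nat :=
  get [set s | forall f, a f -> sign f = s].

Lemma sigmaP (theta : nat -> nat) (a : set (nat -> nat)) (f : nat -> nat) :
  nz_reals theta a -> a f -> sigma a = sign f.
Proof.
have cs s : forall g, applicable theta s g -> contractions theta s g 0 = g 0.
  elim: s => //= n s IH g /and3P[n0 _ /IH]; rewrite /contractions /= => ->.
  by rewrite /contraction; case: n n0.
have rs b g : realize theta b g -> exists2 h, b h & sign g = sign h.
  move=> [h bh /(_ 1 isT)[s /cs sg /(_ 0 isT) E]].
  by exists h => //; rewrite /sign -E sg.
have Bs b g h : base theta b -> b g -> b h -> sign g = sign h.
  have W1s p : W1 theta p -> sign p.2 = sign p.1.
    by move=> [_ [_ [N [[N0 _ _] e _ _]]]]; rewrite /sign e.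
  case=> [[p _ ->] [q [/W1s qs [_ q1] qE]] [q' [/W1s qs' [_ q1'] qE']]|].
    by case: qE => ->; case: qE' => ->; rewrite ?qs ?qs' q1 q1'.
  by move=> [k _ ->] [_ [_ ->]] [_ [_ ->]].
move=> [[[b [Bb _] <-]|-> []//] _] af.
have [h bh fh] := rs _ _ af.
have sf : [set s | forall g, realize theta b g -> sign g = s] (sign f).
  by move=> g /rs[k bk ->]; rewrite fh (Bs b k h).
by rewrite (getI sf f af).
Qed.

Inductive leR (theta : nat -> nat) (a b : set (nat -> nat)) : Prop :=
| leR_sign of nz_reals theta a & nz_reals theta b & sigma a < sigma b
| leR_pos of nz_reals theta a & nz_reals theta b &
    sigma a = 1 & sigma b = 1 &
    (forall f, a f -> exists2 g, b g & forall n, 0 < n -> f n <= g n)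
| leR_neg of nz_reals theta a & nz_reals theta b &
    sigma a = 0 & sigma b = 0 &
    (forall g, b g -> exists2 f, a f & forall n, 0 < n -> f n >= g n)
| leR_neg_zero of nz_reals theta a & b = zeroR theta & sigma a = 0
| leR_zero_pos of a = zeroR theta & nz_reals theta b & sigma b = 1
| leR_zero_zero of a = zeroR theta & b = zeroR theta.

(* Main.v *)
Require Import Defs.
From mathcomp Require Import all_boot.
From mathcomp Require Import boolp classical_sets.
From mathcomp Require Import zify.

(** Read [f] as the number with digits [f 1, f 2, ...] in the mixed radix
    system [theta]. A contraction never decreases the value of the first [K]
    digits, so an element realizing [h] has truncations bounded by those of
    [h]. Each element of the base set has a primary member whose truncations
    are the largest, and this member itself lies in the real number. Pointwise
    domination in both directions therefore makes the truncations of the two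
    largest members equal, hence their digits as well. *)

Set Implicit Arguments.
Unset Strict Implicit.
Unset Printing Implicit Defensive.

(* The value of the digits [f 1, ..., f K], in units of the position [K];
   [theta 0] is multiplied by [0]. *)
Fixpoint numer (theta f : nat -> nat) (K : nat) : nat :=
  if K is k.+1 then numer theta f k * theta k + f k.+1 else 0.

Lemma numer_mono theta f g : (forall n, 0 < n -> f n <= g n) ->
  forall K, numer theta f K <= numer theta g K.
Proof.
move=> fg; elim=> //= K IH.
by rewrite leq_add ?fg// leq_mul2r IH orbT.
Qed.

Lemma eq_numer theta f g : (forall n, 0 < n -> f n = g n) ->
  numer theta f =1 numer theta g.
Proof. by move=> fg; elim=> //= K ->; rewrite fg. Qed.

Lemma numer_inj theta f g : numer theta f =1 numer theta g ->
  forall n, 0 < n -> f n = g n.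
Proof.
move=> E [//|n] _; have := E n.+1.
by rewrite /= E => /eqP; rewrite eqn_add2l => /eqP.
Qed.

(** The carry trades [theta n] units of position [n.+1] for one unit of position [n]; the truncation
    sees this only when it cuts between the two. *)
Lemma numer_contraction theta n f K : 0 < n -> theta n <= f n.+1 ->
  numer theta (contraction theta n f) K = numer theta f K + (K == n).
Proof.
move=> n0 fn; elim: K => [|K IH] /=; first by case: n n0 {fn}.
rewrite IH /contraction eqSS; case: (eqVneq K n) => [->|Kn].
  by rewrite (gtn_eqF (ltnSn n)); nia.
by case: eqVneq => [<-|_] /=; lia.
Qed.

Lemma numer_contractions theta s f K : applicable theta s f ->
  numer theta f K <= numer theta (contractions theta s f) K.
Proof.
elim: s f => //= n s IH f /and3P[n0 fn /IH]; apply: leq_trans.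
by rewrite numer_contraction// leq_addr.
Qed.

Definition top_of theta (b : set (nat -> nat)) (h : nat -> nat) : Prop :=
  [/\ primary theta h, b h &
      forall k, b k -> forall K, numer theta k K <= numer theta h K].

Lemma realize_self theta (b : set (nat -> nat)) h : b h -> realize theta b h.
Proof. by move=> bh; exists h => // N _; exists [::]. Qed.

Lemma realize_numer_le theta b h f : top_of theta b h -> realize theta b f ->
  forall K, numer theta f K <= numer theta h K.
Proof.
move=> [_ _ top] [k bk fk] K; apply: leq_trans (top k bk K).
(* [K.+1] rather than [K], since agreement is given for positive bounds only. *)
have [s sf E] := fk K.+1 isT.
apply: leq_trans (numer_contractions K sf) _.
suff EK m : m <= K.+1 ->
    numer theta (contractions theta s f) m = numer theta k m by rewrite EK.
by elim: m => //= m IH mK; rewrite IH ?(ltnW mK)// E.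
Qed.

(** As with 0.999... and 1: [p.2] ends in maximal digits and [p.1] in zeros, and from position [N]
    on the truncation of [p.2] stays behind. *)
Lemma W1_numer_le theta p : system_function theta -> W1 theta p ->
  forall K, numer theta p.2 K <= numer theta p.1 K.
Proof.
move=> htheta [_ [_ [N [[N0 maxN _] eqN pN p0]]]].
have lt_numer K : numer theta p.2 (N + K) < numer theta p.1 (N + K).
  (* A deficit of one unit becomes [theta (N + K)] units at the next position, and the maximal digit
     there is one less than that. *)
  elim: K => [|K IH]; last first.
    rewrite addnS /= maxN ?p0; try lia.
    have := htheta (N + K); rewrite /=; nia.
  rewrite addn0; case: N N0 eqN pN {maxN p0} => // N _ eqN pN.
  rewrite /= pN addnS ltnS leq_add2r leq_mul2r.
  suff -> : numer theta p.2 N = numer theta p.1 N by rewrite leqnn orbT.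
  have: N <= N by [].
  elim: {-2}N => //= m IH mN; rewrite IH ?(ltnW mN)// eqN//; lia.
move=> K; case: (leqP N K) => [NK|KN].
  by rewrite -(subnKC NK) ltnW.
elim: K KN => //= K IH KN; rewrite eqN// leq_add2r leq_mul2r IH ?orbT//; lia.
Qed.

Lemma base_top theta b : system_function theta -> base theta b ->
  exists h, top_of theta b h.
Proof.
move=> htheta [[p Wp ->]|[h Wh ->]].
  exists p.1; split; first by case: Wp.
    by exists p; split=> //; left.
  move=> k [q [Wq [qp _] [->|->]]] K; rewrite -(eq_numer theta qp) //.
  exact: W1_numer_le.
exists h; split; first by case: Wh.
  by split.
by move=> k [_ [kh _]] K; rewrite (eq_numer theta kh).
Qed.

Lemma same_sign_tail_sym g h : same_sign_tail g h -> same_sign_tail h g.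
Proof. by move=> [e s]; split=> // n n0; rewrite e. Qed.

Lemma same_sign_tail_trans g h k :
  same_sign_tail g h -> same_sign_tail h k -> same_sign_tail g k.
Proof. by move=> [e s] [e' s']; split=> [n n0|]; rewrite ?e ?e' ?s. Qed.

Lemma primary_not_secondary theta h : primary theta h -> ~ secondary theta h.
Proof. by move=> [_ ph] [_ [N N0 mN]]; have [M /mN] := ph N N0. Qed.

(** Since [N] is positive, [W1] restricts the values at [0] only by asking that they agree. Giving
    [p.2] the value [h 0] there yields a partner for [h]. *)
Lemma W1_transfer theta p h : primary theta h -> W1 theta p ->
  (forall n, 0 < n -> h n = p.1 n) -> exists q, W1 theta q /\ h = q.1.
Proof.
move=> ph [_ [[dp2 [N0 N0_gt0 mN0]] [N [[N_gt0 mN minN] eqN pN p0]]]] hp.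
pose k n := if n == 0 then h 0 else p.2 n.
have kE n : 0 < n -> k n = p.2 n by case: n.
have maxE M : 0 < M -> maximal_after theta k M <-> maximal_after theta p.2 M.
  by move=> M0; split=> mM n Mn; have := mM n Mn; rewrite kE//; lia.
exists (h, k); split=> //; split=> //=; split.
  split; first by move=> n n2; rewrite kE ?dp2// ltnW.
  by exists N0 => //; apply/maxE.
exists N; split=> /=.
- by split=> //; [apply/maxE|move=> M M0 /(maxE _ M0); apply: minN].
- by case=> // n nN; rewrite hp// kE// eqN.
- by rewrite hp// kE.
- by move=> n Nn; rewrite hp ?p0//; lia.
Qed.

Lemma F_primary theta (p : nat -> nat) q h : primary theta h -> W1 theta q ->
  same_sign_tail q.1 p -> h = q.1 \/ h = q.2 -> same_sign_tail h p.
Proof.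
by move=> ph [_ [sq _]] qp [->//|hE]; case: (primary_not_secondary ph); rewrite hE.
Qed.

Lemma W1_W2_disjoint theta p g h : W1 theta p -> same_sign_tail g p.1 ->
  W2 theta h -> ~ same_sign_tail g h.
Proof.
move=> Wp gp [ph nW] gh.
have [hp _] := same_sign_tail_trans (same_sign_tail_sym gh) gp.
by have [q [/nW[]]] := W1_transfer ph Wp hp.
Qed.

(** Primary members of an element of [F] are first components, so their tail and sign fix the class.
    By [W1_transfer] no such tail occurs in [W2], which rules out the mixed cases. *)
Lemma base_eq theta b b' h h' : base theta b -> base theta b' ->
  primary theta h -> primary theta h' -> b h -> b' h' ->
  same_sign_tail h h' -> b = b'.
Proof.
move=> [[p Wp ->]|[k Wk ->]] [[p' Wp' ->]|[k' Wk' ->]] ph ph'.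
- move=> [q [Wq qp /(F_primary ph Wq qp) hp]].
  move=> [q' [Wq' qp' /(F_primary ph' Wq' qp') hp']] hh'.
  have pp' := same_sign_tail_trans (same_sign_tail_sym hp)
                (same_sign_tail_trans hh' hp').
  apply/seteqP; split=> x [r [Wr rp xr]]; exists r; split=> //.
    exact: same_sign_tail_trans rp pp'.
  exact: same_sign_tail_trans rp (same_sign_tail_sym pp').
- move=> [q [Wq qp /(F_primary ph Wq qp) hp]] [Wh' _] hh'.
  by case: (W1_W2_disjoint Wp hp Wh').
- move=> [Wh _] [q' [Wq' qp' /(F_primary ph' Wq' qp') hp']] hh'.
  by case: (W1_W2_disjoint Wp' hp' Wh); apply: same_sign_tail_sym.
- move=> [_ hk] [_ hk'] hh'.
  have kk' := same_sign_tail_trans (same_sign_tail_sym hk)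
                (same_sign_tail_trans hh' hk').
  apply/seteqP; split=> x [Wx xk]; split=> //.
    exact: same_sign_tail_trans xk kk'.
  exact: same_sign_tail_trans xk (same_sign_tail_sym kk').
Qed.

(** The order on positive numbers is [dominated a b], on negative ones [dominated b a]; one
    antisymmetry lemma serves both signs. *)
Definition dominated (a b : set (nat -> nat)) : Prop :=
  forall f, a f -> exists2 g, b g & forall n, 0 < n -> f n <= g n.

Lemma nz_reals_base theta a : nz_reals theta a ->
  exists2 b, base theta b & a = realize theta b.
Proof. by move=> [[[b [Bb _] <-]|->] // nz]; [exists b|case: nz]. Qed.

Lemma dominated_anti theta a b : system_function theta ->
  nz_reals theta a -> nz_reals theta b -> sigma a = sigma b ->
  dominated a b -> dominated b a -> a = b.
Proof.
move=> htheta nza nzb; move: (nza) (nzb).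
move=> /nz_reals_base[c Bc aE] /nz_reals_base[d Bd bE] sab ab ba.
have [h top_h] := base_top htheta Bc; have [k top_k] := base_top htheta Bd.
have [ph ch _] := top_h; have [pk dk _] := top_k.
have ah : a h by rewrite aE; apply: realize_self.
have bk : b k by rewrite bE; apply: realize_self.
(* [h] lies below some [g] in [b], whose truncations are at most those of [k]; the next line is the
   converse. *)
have [g + hg] := ab h ah; rewrite bE => /(realize_numer_le top_k) gk.
have [f + kf] := ba k bk; rewrite aE => /(realize_numer_le top_h) fh.
suff -> : c = d by [].
apply: (base_eq Bc Bd ph pk ch dk); split.
  apply: (@numer_inj theta) => K; apply/eqP; rewrite eqn_leq.
  by rewrite (leq_trans (numer_mono _ hg K))// (leq_trans (numer_mono _ kf K)).
by rewrite -(sigmaP nza ah) -(sigmaP nzb bk).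
Qed.

Theorem mainTheorem3 (theta : nat -> nat) (htheta : system_function theta)
    (a b : set (nat -> nat)) (ha : reals theta a) (hb : reals theta b) :
  leR theta a b -> leR theta b a -> a = b.
Proof.
have nz0 c : nz_reals theta c -> c = zeroR theta -> False by case.
case=> [nza nzb lt_ab|nza nzb sa sb ab|nza nzb sa sb ba|nza bE sa
       |aE nzb sb|aE bE];
case=> [nzb' nza' lt_ba|nzb' nza' sb' sa' ba'|nzb' nza' sb' sa' ab'
       |nzb' aE' sb'|bE' nza' sa'|bE' aE'];
  (* Mixed clauses clash in sign or in being zero; only the two cases of equal sign survive. *)
  try (by exfalso; eauto); try (by exfalso; lia); try congruence.
- by apply: (dominated_anti htheta) => //; rewrite sa sb.
- by apply: (dominated_anti htheta) => //; rewrite sa sb.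
Qed.
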